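(* Let $a$ be an equidistant sequence in $\Bbbk$, with $a_{m+k}-a_k=c\cdot m$ for all $m,k\in\mathbb Z$. The functions $\Lambda_{k;a}(x_1,\ldots,x_n)$ and $S_{k;a}(x_1,\ldots,x_n)$ ($k\ge0$), and hence all multiparameter ribbon Schur functions $R_{I;a}(x_1,\ldots,x_n)$, are, for every $1\le i\le n-1$, symmetric under the exchange $$(x_i,x_{i+1})\longleftrightarrow(x_{i+1}-c,\,x_i+c),$$ i.e. $f(x_1,\ldots,x_i,x_{i+1},\ldots,x_n)=f(x_1,\ldots,x_{i+1}-c,\,x_i+c,\ldots,x_n)$ for each such function $f$.
   Context: $\Bbbk$ is a field of characteristic zero, $a=(a_i)_{i\in\mathbb Z}$ a sequence in $\Bbbk$, and $x_1,\ldots,x_n$ noncommuting indeterminates; all identities take place in the free skew field generated by them over $\Bbbk$. Put $(y\downarrow a)^k=(y-a_1)\cdots(y-a_k)$, $(y\downarrow a)^0=1$, $(\tau^s a)_i=a_{i+s}$ for $s\in\mathbb Z$, and $\hat a_i=-a_{-i+1}$. Quasideterminants: for an $n\times n$ matrix $A$ over a unital ring such that the matrix $A^{pq}$ (delete row $p$ and column $q$) is invertible, $|A|_{pq}=a_{pq}-r(A^{pq})^{-1}c$, where $r$ is the $p$-th row of $A$ with $a_{pq}$ removed and $c$ is the $q$-th column of $A$ with $a_{pq}$ removed. Specializations: let $t$ be a central variable, with all expressions in $t$ expanded as formal power series in $1/t$. The elements $\Lambda_{k;a}(x_1,\ldots,x_n)$ are defined by $\sum_{k\ge0}\Lambda_{k;a}(x_1,\ldots,x_n)/(-t\downarrow\hat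 a)^k=|M|_{n+1,n+1}$, where $M$ is the $(n+1)\times(n+1)$ matrix with rows indexed by $m=0,\ldots,n$ whose row $m$ is $\bigl((x_1\downarrow\tau^{1-n}a)^m,(x_2\downarrow\tau^{2-n}a)^m,\ldots,(x_n\downarrow a)^m,1/(t\downarrow\tau^{-(n-m)}a)^{n-m}\bigr)$. The elements $S_{k;a}(x_1,\ldots,x_n)$ are determined by $\bigl(\sum_{k\ge0}S_{k;a}(x_1,\ldots,x_n)/(t\downarrow a)^k\bigr)\bigl(\sum_{k\ge0}\Lambda_{k;a}(x_1,\ldots,x_n)/(-t\downarrow\hat a)^k\bigr)=1$. Ribbon Schur functions: let $S_{k;a}$, $k\ge1$, be free noncommuting generators, $S_{0;a}=1$, and define $S_{k;a}^{[s]}$ for $s\in\mathbb Z$ by $\sum_{k\ge0} S_{k;a}^{[s]}/(t\downarrow\tau^{-s}a)^k=\sum_{k\ge0}S_{k;a}/(t\downarrow a)^k$. For a composition $I=(i_1,\ldots,i_r)$ (positive integers) and $s_k=\sum_{\nu=k}^{r-1}i_\nu$ ($s_r=0$), $R_{I;a}=(-1)^{r-1}|A|_{1r}$, where $A_{pq}=S_{i_p+\cdots+i_q;a}^{[s_p]}$ if $p\le q$, $A_{q+1,q}=1$, $A_{pq}=0$ if $p>q+1$; it is a polynomial in the $S_{k;a}$. $R_{I;a}(x_1,\ldots,x_n)$ is obtained by substituting $S_{k;a}(x_1,\ldots,x_n)$ for $S_{k;a}$. *)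

(* Defs.v *)
From HB Require Import structures.
From mathcomp Require Import all_boot all_order all_algebra.
From mathcomp Require Import boolp classical_sets.
From mathcomp.multinomials Require Import monalg.

Set Implicit Arguments.
Unset Strict Implicit.
Unset Printing Implicit Defensive.

Import GRing.Theory.
Local Open Scope ring_scope.

(* An element of [fps R] is the formal power series
   \sum_j (fps_coef f j) t^-j in 1/t, with t central. *)
Record fps (R : Type) := Fps { fps_coef : nat -> R }.

HB.instance Definition _ (R : Type) := gen_eqMixin (fps R).
HB.instance Definition _ (R : Type) := gen_choiceMixin (fps R).

Section PowerSeries.
Variable R : nzRingType.
Implicit Types f g h : fps R.

Lemma fpsP f g : fps_coef f =1 fps_coef g -> f = g.
Proof. by case: f g => f [g] /= /funext ->. Qed.

Definition fps_const (c : R) := Fps (fun j => if j is 0%N then c else 0).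
Definition fps_opp f := Fps (fun j => - fps_coef f j).
Definition fps_add f g := Fps (fun j => fps_coef f j + fps_coef g j).
Definition fps_mul f g :=
  Fps (fun j => \sum_(i < j.+1) fps_coef f i * fps_coef g (j - i)).

Let trunc N f : {poly R} := \poly_(j < N) fps_coef f j.

Let mul_trunc N f g j : (j < N)%N ->
  fps_coef (fps_mul f g) j = (trunc N f * trunc N g)`_j.
Proof.
move=> jN; rewrite coefM; apply: eq_bigr => i _.
rewrite !coef_poly (leq_ltn_trans _ jN) ?(leq_ltn_trans (leq_subr _ _) jN) //.
by rewrite -ltnS.
Qed.

Let trunc_mul N f g j : (j < N)%N ->
  (trunc N (fps_mul f g))`_j = (trunc N f * trunc N g)`_j.
Proof. by move=> jN; rewrite coef_poly jN (mul_trunc _ _ jN). Qed.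

Fact fps_addA : associative fps_add.
Proof. by move=> f g h; apply: fpsP => j /=; rewrite addrA. Qed.
Fact fps_addC : commutative fps_add.
Proof. by move=> f g; apply: fpsP => j /=; rewrite addrC. Qed.
Fact fps_add0 : left_id (fps_const 0) fps_add.
Proof. by move=> f; apply: fpsP => -[|j] /=; rewrite add0r. Qed.
Fact fps_addN : left_inverse (fps_const 0) fps_opp fps_add.
Proof. by move=> f; apply: fpsP => -[|j] /=; rewrite addNr. Qed.

HB.instance Definition _ :=
  GRing.isZmodule.Build (fps R) fps_addA fps_addC fps_add0 fps_addN.

Fact fps_mulA : associative fps_mul.
Proof.
move=> f g h; apply: fpsP => j; rewrite !(mul_trunc _ _ (ltnSn j)).
transitivity ((trunc j.+1 f * (trunc j.+1 g * trunc j.+1 h))`_j).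
  rewrite !coefM; apply: eq_bigr => i _; congr (_ * _).
  by rewrite trunc_mul // ltnS leq_subr.
rewrite mulrA !coefM; apply: eq_bigr => i _; congr (_ * _).
by rewrite trunc_mul.
Qed.

Fact fps_mul1 : left_id (fps_const 1) fps_mul.
Proof.
move=> f; apply: fpsP => j /=.
by rewrite big_ord_recl mul1r subn0 big1 ?addr0 // => i _; rewrite mul0r.
Qed.
Fact fps_mulr1 : right_id (fps_const 1) fps_mul.
Proof.
move=> f; apply: fpsP => j /=.
rewrite big_ord_recr /= subnn mulr1 big1 ?add0r // => i _.
by case: (j - i)%N (ltn_ord i) (subn_gt0 i j) => [-> //|k _ _]; rewrite mulr0.
Qed.
Fact fps_mulDl : left_distributive fps_mul fps_add.
Proof.
move=> f g h; apply: fpsP => j /=; rewrite -big_split /=.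
by apply: eq_bigr => i _; rewrite mulrDl.
Qed.
Fact fps_mulDr : right_distributive fps_mul fps_add.
Proof.
move=> f g h; apply: fpsP => j /=; rewrite -big_split /=.
by apply: eq_bigr => i _; rewrite mulrDr.
Qed.
Fact fps_oner_neq0 : fps_const 1 != 0 :> fps R.
Proof.
apply/eqP => /(congr1 (fun f => fps_coef f 0%N)) /= /eqP.
by rewrite oner_eq0.
Qed.

HB.instance Definition _ := GRing.Zmodule_isNzRing.Build (fps R)
  fps_mulA fps_mul1 fps_mulr1 fps_mulDl fps_mulDr fps_oner_neq0.

Lemma fps_coef1 j : fps_coef (1 : fps R) j = (j == 0%N)%:R.
Proof. by case: j. Qed.
Lemma fps_coefD f g j : fps_coef (f + g) j = fps_coef f j + fps_coef g j.
Proof. by []. Qed.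
Lemma fps_coefN f j : fps_coef (- f) j = - fps_coef f j.
Proof. by []. Qed.
Lemma fps_coefM f g j :
  fps_coef (f * g) j = \sum_(i < j.+1) fps_coef f i * fps_coef g (j - i).
Proof. by []. Qed.
Lemma fps_coefCM c f j : fps_coef (fps_const c * f) j = c * fps_coef f j.
Proof.
rewrite fps_coefM big_ord_recl /= subn0 big1 ?addr0 // => i _.
by rewrite mul0r.
Qed.
Lemma fps_coef_sum I (r : seq I) P (F : I -> fps R) j :
  fps_coef (\sum_(i <- r | P i) F i) j = \sum_(i <- r | P i) fps_coef (F i) j.
Proof.
by apply: (big_morph (fun f => fps_coef f j)) => //; case: j.
Qed.

(* The sum of a family (F k) with F k of order at least k in 1/t; only the
   terms k <= j contribute to the coefficient of t^-j. *)
Definition fps_sum (F : nat -> fps R) : fps R :=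
  Fps (fun j => \sum_(k < j.+1) fps_coef (F k) j).

Lemma fps_linv f : fps_coef f 0%N = 1 -> exists g, g * f = 1.
Proof.
move=> f0; have [h hE] : exists h, h = 1 - f by exists (1 - f).
have h0 : fps_coef h 0%N = 0 by rewrite hE fps_coefD fps_coefN f0 /= subrr.
have hX k j : (j < k)%N -> fps_coef (h ^+ k) j = 0.
  elim: k j => // k IH j jk; rewrite exprSr fps_coefM big1 // => -[i /= ij] _.
  case E: (j - i)%N => [|d]; first by rewrite h0 mulr0.
  by rewrite IH ?mul0r //; apply: (@leq_trans j) => //; rewrite -subn_gt0 E.
exists (fps_sum (fun k => h ^+ k)); apply: fpsP => j.
transitivity (fps_coef ((\sum_(k < j.+1) h ^+ k) * f) j).
  rewrite !fps_coefM; apply: eq_bigr => -[i /= ij] _; congr (_ * _).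
  rewrite fps_coef_sum /= (big_ord_widen j.+1 (fun k => fps_coef (h ^+ k) i)) //.
  rewrite [RHS](bigID (fun k : 'I__ => (k < i.+1)%N)) /=.
  by rewrite [X in _ = _ + X]big1 ?addr0 // => k; rewrite -leqNgt => /hX.
have -> : f = 1 - h by rewrite hE opprB addrC subrK.
have -> : (\sum_(k < j.+1) h ^+ k) * (1 - h) = 1 - h ^+ j.+1.
  elim: j.+1 => [|m IH]; first by rewrite big_ord0 mul0r expr0 subrr.
  rewrite big_ord_recr /= mulrDl IH mulrBr mulr1 -exprSr addrA subrK //.
by rewrite fps_coefD fps_coefN hX // subr0.
Qed.

End PowerSeries.

Section FactorialPowers.
Variables (K : fieldType) (A : lalgType K).
Implicit Types (b : int -> K) (e : K).

(* (y | b)^m *)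
Definition ffact b (y : A) (m : nat) : A :=
  \prod_(1 <= l < m.+1) (y - (b l%:Z)%:A).

Definition shift (s : int) b : int -> K := fun i => b (i + s).
Definition hat b : int -> K := fun i => - b (- i + 1).

(* The expansion of 1/(e t - z) in powers of 1/t; e is 1 or -1 below. *)
Definition inv_lin e (z : K) : fps A :=
  Fps (fun j => if j is i.+1 then (e ^- j * z ^+ i)%:A else 0).

Lemma inv_linP e z : e != 0 ->
  (fps_const e%:A - Fps (fun j => if j is 1%N then z%:A else 0)) * inv_lin e z
  = Fps (fun j => if j is 1%N then 1 else 0).
Proof.
move=> e0; have AM (p q : K) : p%:A * q%:A = (p * q)%:A :> A.
  by rewrite -scalerAl mul1r scalerA.
apply: fpsP => j; rewrite mulrBl fps_coefD fps_coefN fps_coefCM fps_coefM.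
case: j => [|[|j]].
- by rewrite big_ord1 /= mulr0 mul0r subr0.
- rewrite !big_ord_recl big_ord0 /= mul0r mulr0 !addr0 subr0 AM.
  by rewrite mulr1 mulfV ?scale1r.
- rewrite 2!big_ord_recl /= mul0r add0r big1 => [|i _]; last by rewrite mul0r.
  rewrite addr0 !AM /bump /= subSS subn0 -scalerBl mulrA exprS invfM mulrA.
  by rewrite divff // mul1r (mulrCA z) -exprS subrr scale0r.
Qed.

(* 1/(e t | b)^m *)
Definition inv_ffact e b (m : nat) : fps A :=
  \prod_(1 <= l < m.+1) inv_lin e (b l%:Z).

Definition fact_series e b (L : nat -> A) : fps A :=
  fps_sum (fun k => fps_const (L k) * inv_ffact e b k).

(* The sequence L such that \sum_k L_k/(e t | b)^k = F. *)
Definition fact_coefs e b (F : fps A) : nat -> A :=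
  xget (fun=> 0) [set L | fact_series e b L = F]%classic.

Lemma inv_ffactS e b m :
  inv_ffact e b m.+1 = inv_ffact e b m * inv_lin e (b m.+1%:Z).
Proof. exact: big_nat_recr. Qed.

Lemma inv_ffact_lt e b m j : (j < m)%N -> fps_coef (inv_ffact e b m) j = 0.
Proof.
elim: m j => // m IH j jm; rewrite inv_ffactS fps_coefM big1 // => -[i /= ij] _.
case E: (j - i)%N => [|d] /=; first by rewrite mulr0.
by rewrite IH ?mul0r //; apply: (@leq_trans j) => //; rewrite -subn_gt0 E.
Qed.

Lemma inv_ffact_diag e b m : fps_coef (inv_ffact e b m) m = (e ^- m)%:A.
Proof.
elim: m => [|m IH]; first by rewrite /inv_ffact big_geq // expr0 invr1 scale1r.
rewrite inv_ffactS fps_coefM.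
rewrite big_ord_recr /= subnn mulr0 addr0 big_ord_recr /= big1 => [|i _].
  rewrite add0r subSnn IH /= expr1 expr0 mulr1 -scalerAl mul1r scalerA.
  by rewrite -invfM mulrC -exprS.
by rewrite inv_ffact_lt ?mul0r.
Qed.

Lemma fact_series_coef e b L j : fps_coef (fact_series e b L) j =
  \sum_(k < j) L k * fps_coef (inv_ffact e b k) j + L j * (e ^- j)%:A.
Proof.
transitivity (\sum_(k < j.+1) L k * fps_coef (inv_ffact e b k) j).
  by apply: eq_bigr => k _; exact: fps_coefCM.
by rewrite big_ord_recr /= inv_ffact_diag.
Qed.

Lemma fact_series_inj e b : e != 0 -> injective (fact_series e b).
Proof.
move=> e0 L L' eqL; apply/funext => j; elim/ltn_ind: j => j IH.
have := congr1 (fun f => fps_coef f j) eqL; rewrite !fact_series_coef.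
under eq_bigr => k _ do rewrite IH //.
move/addrI/(congr1 (fun y => y * (e ^+ j)%:A)).
rewrite -!mulrA -[_%:A * _%:A]scalerAl mul1r scalerA mulVf ?expf_neq0 //.
by rewrite scale1r !mulr1.
Qed.

Lemma fact_coefsK e b F : e != 0 -> fact_series e b (fact_coefs e b F) = F.
Proof.
move=> e0; apply: (@xgetPex _ _ [set L | fact_series e b L = F]%classic).
have step N : exists L, forall j, (j < N)%N ->
    fps_coef (fact_series e b L) j = fps_coef F j.
  elim: N => [|N [L IH]]; first by exists (fun=> 0).
  pose v := (fps_coef F N - \sum_(k < N) L k * fps_coef (inv_ffact e b k) N)
              * (e ^+ N)%:A.
  exists (fun j => if j == N then v else L j) => j.
  rewrite ltnS fact_series_coef => jN.
  under eq_bigr => k _ do rewrite (ltn_eqF (leq_trans (ltn_ord k) jN)).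
  move: jN; rewrite leq_eqVlt; case: eqVneq => [-> _|_ /= jN].
    rewrite /v -mulrA -scalerAl mul1r scalerA mulfV ?expf_neq0 // scale1r.
    by rewrite mulr1 addrC subrK.
  by rewrite -IH // fact_series_coef.
pose G N := xget (fun=> 0) [set L : nat -> A | forall j, (j < N)%N ->
    fps_coef (fact_series e b L) j = fps_coef F j]%classic.
have GP N j : (j < N)%N ->
    fps_coef (fact_series e b (G N)) j = fps_coef F j.
  by move: j; apply: (@xgetPex _ _ [set L : nat -> A | forall j, (j < N)%N ->
    fps_coef (fact_series e b L) j = fps_coef F j]%classic); exact: step.
have GE M N j : (j < M)%N -> (j < N)%N -> G M j = G N j.
  elim/ltn_ind: j => j IH jM jN.
  have := etrans (GP M j jM) (esym (GP N j jN)); rewrite !fact_series_coef.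
  under eq_bigr => k _ do
    rewrite (IH k (ltn_ord k) (ltn_trans (ltn_ord k) jM) (ltn_trans (ltn_ord k) jN)).
  move/addrI/(congr1 (fun y => y * (e ^+ j)%:A)).
  rewrite -!mulrA -[_%:A * _%:A]scalerAl mul1r scalerA mulVf ?expf_neq0 //.
  by rewrite scale1r !mulr1.
exists (fun j => G j.+1 j); apply: fpsP => j.
rewrite -(GP j.+1 j) // !fact_series_coef; congr (_ + _).
by apply: eq_bigr => k _; rewrite (GE k.+1 j.+1) // ltnS ltnW.
Qed.

End FactorialPowers.

Section Quasideterminant.
Variable R : nzRingType.

Definition mx_inverse n (A B : 'M[R]_n) := A *m B = 1%:M /\ B *m A = 1%:M.

(* The two-sided inverse of A; 0 if there is none. *)
Definition mxinv n (A : 'M[R]_n) : 'M[R]_n := xget 0 (mx_inverse A).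

Definition quasidet_defined n (A : 'M[R]_n) (p q : 'I_n) :=
  exists B, mx_inverse (row' p (col' q A)) B.

Definition quasidet n (A : 'M[R]_n) (p q : 'I_n) : R :=
  A p q - (row p (col' q A) *m mxinv (row' p (col' q A)) *m
           col q (row' p A)) 0 0.

Lemma mxinvP n (A B : 'M[R]_n) : mx_inverse A B -> mxinv A = B.
Proof.
move=> AB; apply: xget_unique => // C [_ CA]; case: AB => AB _.
by rewrite -[C]mulmx1 -AB mulmxA CA mul1mx.
Qed.

Lemma unitriangular_inverse n (A : 'M[R]_n) :
  (forall i, A i i = 1) -> (forall i j : 'I_n, (j < i)%N -> A i j = 0) ->
  exists B, mx_inverse A B.
Proof.
case: n A => [|n] A A1 A0.
  by exists 1%:M; split; apply/matrixP => -[].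
pose N := 1 - A.
have N0 k (i j : 'I_n.+1) : (j < i + k)%N -> (N ^+ k) i j = 0.
  elim: k i j => [|k IH] i j.
    by rewrite addn0 expr0 !mxE => ji; rewrite -val_eqE /= gtn_eqF.
  move=> jik; rewrite exprSr mxE big1 // => l _.
  have [li|il] := ltnP l (i + k); first by rewrite IH ?mul0r.
  rewrite !mxE; have [->|nlj] := eqVneq l j; first by rewrite A1 subrr mulr0.
  rewrite A0 ?subrr ?mulr0 // ltn_neqAle eq_sym nlj.
  by rewrite (leq_trans _ il) // -ltnS -addnS.
have NX : N ^+ n.+1 = 0.
  by apply/matrixP => i j; rewrite N0 ?mxE // ltn_addl.
have AE : A = 1 - N by rewrite /N opprB addrC subrK.
exists (\sum_(k < n.+1) N ^+ k); split.
  rewrite AE; apply/eqP; rewrite -[_ *m _]/(_ * _) -opprB mulNr -subrX1 NX.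
  by rewrite sub0r opprK.
rewrite AE -[_ *m _]/(_ * _) -commr_sum.
  by rewrite -opprB mulNr -subrX1 NX sub0r opprK.
by move=> k _; apply: commrX; apply: commr_sym; apply: commrB => //; exact: commr1.
Qed.

End Quasideterminant.

Section Specializations.
Variables (K : fieldType) (A : lalgType K) (n : nat).
Variables (a : int -> K) (x : 'I_n -> A).

(* The indices of x and of the rows and columns are 0-based, so that x l is
   x_(l+1). *)
Definition Lambda_mx : 'M[fps A]_n.+1 :=
  \matrix_(m, j)
    if unlift ord_max j is Some l
    then fps_const (ffact (shift (l.+1%:Z - n%:Z) a) (x l) m)
    else inv_ffact A 1 (shift (- (n - m)%:Z) a) (n - m).

Definition Lambda_defined := quasidet_defined Lambda_mx ord_max ord_max.

Definition Lambda : nat -> A :=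
  fact_coefs (-1) (hat a) (quasidet Lambda_mx ord_max ord_max).

Definition Sfun : nat -> A :=
  xget (fun=> 0) [set s | fact_series 1 a s *
                          fact_series (-1) (hat a) Lambda = 1]%classic.

Lemma Lambda_quasidet0 : fps_coef (quasidet Lambda_mx ord_max ord_max) 0%N = 1.
Proof.
rewrite fps_coefD fps_coefN !mxE unlift_none subnn /inv_ffact big_geq //=.
rewrite fps_coef_sum big1 ?subr0 // => j _.
rewrite fps_coefM big_ord1 !mxE unlift_none inv_ffact_lt ?mulr0 // subn_gt0.
by rewrite lift_max.
Qed.

Lemma SfunP s : fact_series 1 a s * fact_series (-1) (hat a) Lambda = 1
  <-> s = Sfun.
Proof.
have e0 : -1 != 0 :> K by rewrite oppr_eq0 oner_eq0.
rewrite /Sfun /Lambda fact_coefsK //.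
set F := quasidet _ _ _; have [G GF] := fps_linv Lambda_quasidet0.
have G0 : fps_coef G 0%N = 1.
  have := congr1 (fun f => fps_coef f 0%N) GF.
  by rewrite fps_coefM big_ord1 Lambda_quasidet0 mulr1.
have FG : F * G = 1.
  have [H HG] := fps_linv G0.
  by rewrite -[F]mul1r -HG -(mulrA H) GF mulr1 HG.
have inj := @fact_series_inj _ A 1 a (oner_neq0 K).
rewrite (@xget_unique _ _ _ (fact_coefs 1 a G)).
- split=> [sF|->]; last by rewrite fact_coefsK ?oner_neq0.
  apply: inj; rewrite fact_coefsK ?oner_neq0 //.
  by rewrite -[LHS]mulr1 -FG mulrA sF mul1r.
- by rewrite /= fact_coefsK ?oner_neq0.
- move=> s' /= sF; apply: inj; rewrite fact_coefsK ?oner_neq0 //.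
  by rewrite -[LHS]mulr1 -FG mulrA sF mul1r.
Qed.

End Specializations.

Section Ribbon.
Variables (K : fieldType) (a : int -> K).

(* The free K-algebra on countably many generators; the generator with index
   k stands for S_(k+1). *)
Definition free_alg : lalgType K := {malg K[{fmonom nat}]}.

Definition Sgen (k : nat) : free_alg :=
  if k is i.+1 then << fmu i >> else 1.

Definition Sshift (s : int) : nat -> free_alg :=
  fact_coefs 1 (shift (- s) a) (fact_series 1 a Sgen).

(* The composition I = (i_1, ..., i_(r+1)) is a tuple of length r+1, and rows,
   columns and parts are indexed from 0. *)
Definition ribbon_mx r (I : r.+1.-tuple nat) : 'M[free_alg]_r.+1 :=
  \matrix_(p, q)
    if (p <= q)%N
    then Sshift (\sum_(p <= v < r) nth 0 I v)%N%:Z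
                (\sum_(p <= v < q.+1) nth 0 I v)%N
    else if p == q.+1 :> nat then 1 else 0.

Definition ribbon r (I : r.+1.-tuple nat) : free_alg :=
  (-1) ^+ r * quasidet (ribbon_mx I) ord0 ord_max.

Lemma ribbon_defined r (I : r.+1.-tuple nat) :
  quasidet_defined (ribbon_mx I) ord0 ord_max.
Proof.
apply: unitriangular_inverse => [i|i j ji]; rewrite !mxE lift0 lift_max.
  by rewrite ltnn eqxx.
by rewrite ltnNge ltnW //= eqSS gtn_eqF.
Qed.

Definition eval_free (A : lalgType K) (s : nat -> A) (f : free_alg) : A :=
  mmap (in_alg A) (fun w : {fmonom nat} => \prod_(i <- w) s i.+1) f.

Definition ribbon_at (A : lalgType K) n (x : 'I_n -> A) r
    (I : r.+1.-tuple nat) : A :=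
  eval_free (Sfun a x) (ribbon I).

End Ribbon.

Definition skew_field (D : unitRingType) :=
  forall d : D, d != 0 -> d \is a GRing.unit.

(* D is the free skew field over K on the family x, i.e. the universal field
   of fractions of the free algebra K<x_1, ..., x_n> (P. M. Cohn): it is
   generated by x as a skew field over K, and every assignment x |-> y into a
   skew field E over K extends to a specialization, that is, to a K-algebra
   morphism phi on a subalgebra L of D in which every element outside the
   kernel of phi is invertible. *)
Record free_skew_field (K : fieldType) (n : nat) (D : unitAlgType K)
    (x : 'I_n -> D) : Prop := FreeSkewField {
  free_skew_field_skew : skew_field D;
  free_skew_field_gen : forall P : {pred D},
    divalg_closed P -> (forall i, x i \in P) -> forall d, d \in P;
  free_skew_field_univ : forall (E : unitAlgType K) (y : 'I_n -> E),
    skew_field E ->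
    exists (L : {pred D}) (phi : D -> E),
      [/\ subalg_closed L /\ (forall i, x i \in L),
          phi 1 = 1 /\ (forall c : K, {in L &, forall u v,
                          phi (c *: u + v) = c *: phi u + phi v}),
          {in L &, {morph phi : u v / u * v}},
          forall i, phi (x i) = y i &
          {in L, forall d, phi d != 0 -> d^-1 \in L}] }.

(* (x_i, x_i1) <-> (x_i1 - c, x_i + c), for i1 the successor of i. *)
Definition exchange (K : fieldType) (A : lalgType K) (n : nat) (c : K)
    (i i1 : 'I_n) (x : 'I_n -> A) : 'I_n -> A :=
  fun j => if j == i then x i1 - c%:A
           else if j == i1 then x i + c%:A else x j.

(* Main.v *)
Require Import Defs.
From HB Require Import structures.
From mathcomp Require Import all_boot all_order all_algebra.
From mathcomp Require Import perm.
From mathcomp Require classical_sets.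

(** For an equidistant sequence a shift is a translation, a_(l+s) = a_l + c s,
    so (y | tau^s a)^m = (y - c s | a)^m. Hence the column of the matrix M that
    belongs to x_l depends only on z_l = x_l - c (l - n) (with l counted from
    1), and in these coordinates the exchange
    (x_i, x_(i+1)) <-> (x_(i+1) - c, x_i + c) is z_i <-> z_(i+1). It thus
    permutes two columns of M other than the last one, which does not change
    |M|_(n+1,n+1) (lemma [quasidet_col_perm]). The generating series of the
    Lambda_k is therefore symmetric, and the S_k and the ribbon functions are
    computed from the Lambda_k.

    It remains to see that the quasideterminant exists, that is, that the
    noncommutative Vandermonde-type matrix V of the (z_l | a)^m is invertible
    over the free skew field D. In characteristic zero the z_l may be
    specialized to pairwise distinct integers of the ground field; V then
    becomes an invertible matrix (lemma [ffact_Vandermonde_unit]). The universal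
    property of D realizes this by a morphism on a subalgebra L of D in which every element outside the
    kernel is invertible, so L is a local ring, and a matrix over a local ring
    is invertible as soon as it is invertible over the residue field (lemma
    [spec_invertible]). *)

Set Implicit Arguments.
Unset Strict Implicit.
Unset Printing Implicit Defensive.

Import GRing.Theory.
Local Open Scope ring_scope.

(** * Inverses of matrices and quasideterminants over a ring *)

Lemma mx_inverseC (R : nzRingType) n (A B : 'M[R]_n) :
  mx_inverse A B -> mx_inverse B A.
Proof. by case. Qed.

Lemma mx_inverseM (R : nzRingType) n (A A' B B' : 'M[R]_n) :
  mx_inverse A A' -> mx_inverse B B' -> mx_inverse (A *m B) (B' *m A').
Proof.
move=> [AA' A'A] [BB' B'B]; split.
  by rewrite mulmxA -(mulmxA A) BB' mulmx1.
by rewrite mulmxA -(mulmxA B') A'A mulmx1.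
Qed.

Lemma mx_inverse_map (R S : nzRingType) (f : {rmorphism R -> S}) n
    (A B : 'M[R]_n) :
  mx_inverse A B -> mx_inverse (map_mx f A) (map_mx f B).
Proof. by move=> [AB BA]; split; rewrite -map_mxM ?AB ?BA map_mx1. Qed.

Lemma mx_inverse_perm (R : nzRingType) n (s : 'S_n) :
  mx_inverse (perm_mx s : 'M[R]_n) (perm_mx s^-1).
Proof. by split; rewrite -perm_mxM ?fingroup.mulgV ?fingroup.mulVg perm_mx1. Qed.

(** Both sides are 0 when A has no inverse, since A is invertible exactly when
    A *m U is. *)
Lemma mxinvM (R : nzRingType) n (A U U' : 'M[R]_n) :
  mx_inverse U U' -> mxinv (A *m U) = U' *m mxinv A.
Proof.
move=> UU'; have AE : A = A *m U *m U'.
  by rewrite -mulmxA; case: UU' => -> _; rewrite mulmx1.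
have [[B AB]|noB] := boolp.pselect (exists B, mx_inverse A B).
  by rewrite (mxinvP AB) (mxinvP (mx_inverseM AB UU')).
rewrite /mxinv !classical_sets.xgetPN ?mulmx0 // => B AB; apply: noB.
  by exists B.
by rewrite AE; eexists; apply: mx_inverseM AB (mx_inverseC UU').
Qed.

(** |A|_pq = a_pq - r (A^pq)^-1 c, and a permutation of the columns other than
    the q-th one multiplies both r and A^pq by the same permutation matrix on
    the right; the two factors cancel in r (A^pq)^-1. *)
Lemma quasidet_col_perm (R : nzRingType) n (A : 'M[R]_n.+1) p q (s : 'S_n) :
  quasidet (col_perm (lift_perm q q s) A) p q = quasidet A p q.
Proof.
have col'_perm : col' q (col_perm (lift_perm q q s) A) = col_perm s (col' q A).
  by apply/matrixP=> i j; rewrite !mxE lift_perm_lift.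
have row'_perm : row' p (col_perm s (col' q A)) = col_perm s (row' p (col' q A)).
  by apply/matrixP=> i j; rewrite !mxE.
have col_q : col q (row' p (col_perm (lift_perm q q s) A)) = col q (row' p A).
  by apply/matrixP=> i j; rewrite !mxE lift_perm_id.
rewrite /quasidet col'_perm row'_perm col_q [col_perm _ A p q]mxE lift_perm_id.
have -> : row p (col_perm s (col' q A)) = row p (col' q A) *m perm_mx s^-1.
  by rewrite -col_permE; apply/matrixP=> i j; rewrite !mxE.
rewrite col_permE (mxinvM _ (mx_inverse_perm _ _)) mulmxA.
rewrite -(mulmxA _ (perm_mx _) (perm_mx _)) -perm_mxM.
by rewrite fingroup.mulgV perm_mx1 mulmx1.
Qed.

Lemma quasidet_defined_col_perm (R : nzRingType) n (A : 'M[R]_n.+1) p q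
    (s : 'S_n) :
  quasidet_defined A p q -> quasidet_defined (col_perm (lift_perm q q s) A) p q.
Proof.
move=> [B AB]; rewrite /quasidet_defined.
have -> : row' p (col' q (col_perm (lift_perm q q s) A)) =
    row' p (col' q A) *m perm_mx s^-1.
  by rewrite -col_permE; apply/matrixP=> i j; rewrite !mxE lift_perm_lift.
by eexists; apply: mx_inverseM AB (mx_inverse_perm _ _).
Qed.

(** Block LDU decomposition: a matrix with invertible upper left block is
    invertible if the Schur complement of that block is. *)
Lemma mx_inverse_schur (R : nzRingType) m n (P P' : 'M[R]_m) (Q : 'M_(m, n))
    (S : 'M_(n, m)) (T C : 'M_n) :
  mx_inverse P P' -> mx_inverse (T - S *m P' *m Q) C ->
  exists B, mx_inverse (block_mx P Q S T) B.
Proof.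
move=> [PP' P'P] [TC CT].
have tri V : mx_inverse (block_mx 1%:M 0 V 1%:M : 'M[R]_(m + n))
                      (block_mx 1%:M 0 (- V) 1%:M).
  split; rewrite mulmx_block !(mulmx1, mul1mx, mulmx0, mul0mx, addr0, add0r);
  by rewrite ?subrr ?addNr -scalar_mx_block.
have triu V : mx_inverse (block_mx 1%:M V 0 1%:M : 'M[R]_(m + n))
                      (block_mx 1%:M (- V) 0 1%:M).
  split; rewrite mulmx_block !(mulmx1, mul1mx, mulmx0, mul0mx, addr0, add0r);
  by rewrite ?subrr ?addNr -scalar_mx_block.
have diag : mx_inverse (block_mx P 0 0 (T - S *m P' *m Q))
                      (block_mx P' 0 0 C).
  split; rewrite mulmx_block !(mulmx0, mul0mx, addr0, add0r);
  by rewrite ?PP' ?P'P ?TC ?CT -scalar_mx_block.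
have -> : block_mx P Q S T =
    block_mx 1%:M 0 (S *m P') 1%:M *m block_mx P 0 0 (T - S *m P' *m Q) *m
    block_mx 1%:M (P' *m Q) 0 1%:M.
  rewrite !mulmx_block !(mulmx1, mul1mx, mulmx0, mul0mx, addr0, add0r).
  by rewrite mulmxA PP' mul1mx -mulmxA P'P mulmx1 !mulmxA addrC subrK.
by eexists; apply: mx_inverseM (triu _); apply: mx_inverseM (tri _) diag.
Qed.

(** * Matrices over a local subalgebra with residue field K *)

(** The two conditions on units make L a local ring with maximal ideal
    ker phi and residue field K. *)
Record local_specialization (K : fieldType) (D : unitAlgType K)
    (L : {pred D}) (phi : D -> K) : Prop := LocalSpecialization {
  spec_closed : subalg_closed L;
  spec1 : phi 1 = 1;
  spec_lin : forall c : K, {in L &, forall u v,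
    phi (c *: u + v) = c * phi u + phi v};
  spec_mul : {in L &, {morph phi : u v / u * v}};
  spec_unit : {in L, forall d, phi d != 0 -> d \is a GRing.unit};
  spec_inv : {in L, forall d, phi d != 0 -> d^-1 \in L} }.

Section LocalSpecialization.
Variables (K : fieldType) (D : unitAlgType K) (L : {pred D}) (phi : D -> K).
Hypothesis specL : local_specialization L phi.

Lemma spec_in1 : 1 \in L. Proof. by case: specL => -[]. Qed.
Lemma spec_inM : {in L &, forall u v, u * v \in L}.
Proof. by case: specL => -[]. Qed.
Lemma spec_inB : {in L &, forall u v, u - v \in L}.
Proof.
case: specL => -[_ Ll _] _ _ _ _ _ u v Lu Lv.
by rewrite addrC -scaleN1r; exact: Ll.
Qed.
Lemma specB : {in L &, {morph phi : u v / u - v}}.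
Proof.
by move=> u v Lu Lv; rewrite addrC -scaleN1r (spec_lin specL) // mulN1r addrC.
Qed.
Lemma spec_in0 : 0 \in L.
Proof. by rewrite -(subrr 1) spec_inB ?spec_in1. Qed.
Lemma spec0 : phi 0 = 0.
Proof. by rewrite -(subrr 1) specB ?spec_in1 // subrr. Qed.
Lemma spec_inA c : c%:A \in L.
Proof.
case: specL => -[L1 Ll _] _ _ _ _ _.
by rewrite -[_%:A]addr0; apply: Ll => //; exact: spec_in0.
Qed.
Lemma specA c : phi c%:A = c.
Proof.
rewrite -[_%:A]addr0 (spec_lin specL) ?spec_in1 ?spec_in0 //.
by rewrite (spec1 specL) spec0 mulr1 addr0.
Qed.

Lemma spec_inD : {in L &, forall u v, u + v \in L}.
Proof.
move=> u v Lu Lv; rewrite -[v]opprK spec_inB //.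
by rewrite -[- v]add0r spec_inB ?spec_in0.
Qed.
Lemma specD : {in L &, {morph phi : u v / u + v}}.
Proof.
by move=> u v Lu Lv; rewrite -[u]scale1r (spec_lin specL) // mul1r scale1r.
Qed.

Lemma spec_sum I (r : seq I) (F : I -> D) : (forall i, F i \in L) ->
  \sum_(i <- r) F i \in L /\ phi (\sum_(i <- r) F i) = \sum_(i <- r) phi (F i).
Proof.
move=> LF; elim: r => [|i r [IH1 IH2]].
  by rewrite !big_nil spec_in0 spec0.
by rewrite !big_cons spec_inD // specD // IH2.
Qed.

Lemma spec_prod I (r : seq I) (F : I -> D) : (forall i, F i \in L) ->
  \prod_(i <- r) F i \in L /\
  phi (\prod_(i <- r) F i) = \prod_(i <- r) phi (F i).
Proof.
move=> LF; elim: r => [|i r [IH1 IH2]].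
  by rewrite !big_nil spec_in1 (spec1 specL).
by rewrite !big_cons spec_inM // (spec_mul specL) // IH2.
Qed.

(** Gaussian elimination without pivoting: the entry (0, 0) is a unit since its
    residue is 1, and the residue of its Schur complement is again the identity
    because the residues of the eliminated row and column vanish. *)
Lemma spec1_invertible n (C : 'M[D]_n) :
    (forall i j, C i j \in L) -> (forall i j, phi (C i j) = (i == j)%:R) ->
  exists B, mx_inverse C B.
Proof.
elim: n C => [|n IH] C LC phiC.
  by exists 1%:M; split; apply/matrixP => -[].
pose d := C 0 0; have d1 : phi d != 0 by rewrite phiC eqxx oner_neq0.
have dU : d \is a GRing.unit by exact: (spec_unit specL (LC _ _) d1).
have Ld : d^-1 \in L by exact: (spec_inv specL (LC _ _) d1).
have l0 : lshift n (0 : 'I_1) = 0 :> 'I_(1 + n) by exact: val_inj.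
rewrite -[C](submxK (C : 'M_(1 + n))).
set S : 'M_n := drsubmx (C : 'M_(1 + n))
  - dlsubmx (C : 'M_(1 + n)) *m (d^-1)%:M *m ursubmx (C : 'M_(1 + n)).
have SE i j : S i j =
    C (rshift 1 i) (rshift 1 j)
    - C (rshift 1 i) 0 * d^-1 * C 0 (rshift 1 j).
  rewrite !mxE big_ord1 !mxE big_ord1 !mxE.
  by rewrite l0.
have [i j|i j|T ST] := IH S.
- by rewrite SE spec_inB ?spec_inM.
- rewrite SE specB ?spec_inM // !(spec_mul specL) ?spec_inM //.
  by rewrite !phiC /= !mul0r subr0.
- apply: mx_inverse_schur ST.
  have -> : ulsubmx (C : 'M_(1 + n)) = d%:M.
    apply/matrixP => i j; rewrite !mxE !ord1 eqxx mulr1n.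
    by rewrite l0.
  by split; rewrite -scalar_mxM ?divrr ?mulVr.
Qed.

(** Since L contains K, the inverse of the residue matrix of A lifts to a
    matrix of constants; multiplying by it reduces to residue 1. *)
Lemma spec_invertible n (A : 'M[D]_n) : (forall i j, A i j \in L) ->
  map_mx phi A \in unitmx -> exists B, mx_inverse A B.
Proof.
move=> LA phiA.
pose iota := map_mx (in_alg D).
have ext (M : 'M[K]_n) : M \in unitmx ->
    mx_inverse (iota n n M) (iota n n (invmx M)).
  by move=> MU; apply: mx_inverse_map; split; rewrite ?mulmxV ?mulVmx.
have := ext _ phiA; set U := iota n n _; set V := iota n n _ => UV.
have AV i j : (A *m V) i j \in L /\ phi ((A *m V) i j) = (i == j)%:R.
  have LAV k : A i k * V k j \in L by rewrite mxE spec_inM // spec_inA.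
  rewrite mxE; have [-> ->] := spec_sum (index_enum 'I_n) LAV; split=> //.
  transitivity ((map_mx phi A *m invmx (map_mx phi A)) i j).
    rewrite mxE; apply: eq_bigr => k _.
    by rewrite (spec_mul specL) ?mxE ?spec_inA // specA.
  by rewrite mulmxV // mxE.
have [i j|i j|C AVC] := @spec1_invertible _ (A *m V).
- by case: (AV i j).
- by case: (AV i j).
have -> : A = A *m V *m U.
  by rewrite -mulmxA; case: UV => _ ->; rewrite mulmx1.
by eexists; apply: mx_inverseM AVC UV.
Qed.

End LocalSpecialization.

(** * The specialized matrix *)

Lemma pchar0_natr_inj (K : fieldType) (charK : [pchar K] =i pred0) :
  injective (fun m => m%:R : K).
Proof.
have /pcharf0P charK0 := charK.
move=> m p /eqP mp; apply/eqP; rewrite eqn_leq -!subn_eq0 -!charK0.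
case: (leqP m p) => [le_mp|/ltnW le_pm].
  by move: le_mp mp => /[dup]/eqP-> le_mp; rewrite eqxx natrB // subr_eq0 eq_sym.
by move: le_pm mp => /[dup]/eqP-> le_pm; rewrite eqxx natrB // subr_eq0 => ->.
Qed.

(** The (y | a)^m are monic polynomials of degree m in y, so this matrix is a
    lower unitriangular matrix times the Vandermonde matrix of y. *)
Lemma ffact_Vandermonde_unit (K : fieldType) (a : int -> K) n (y : 'I_n -> K) :
  injective y ->
  (\matrix_(m < n, l < n) ffact a (y l : K^o) m : 'M[K]_n) \in unitmx.
Proof.
move=> inj_y; pose P m := \prod_(1 <= l < m.+1) ('X - (a l%:Z)%:P) : {poly K}.
have sizeP m : size (P m) = m.+1.
  by rewrite size_prod_XsubC size_iota subn1.
have -> : \matrix_(m < n, l < n) ffact a (y l : K^o) m =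
   (\matrix_(m < n, j < n) (P m)`_j) *m Vandermonde n (\row_l y l).
  apply/matrixP=> m l; rewrite !mxE.
  transitivity (P m).[y l].
    rewrite horner_prod; apply: eq_bigr => k _.
    by rewrite !hornerE [_%:A]mulr1.
  rewrite (@horner_coef_wide _ n); first by apply: eq_bigr => j _; rewrite !mxE.
  by rewrite sizeP.
rewrite unitmx_mul unitmxE det_trig; last first.
  apply/is_trig_mxP => i j ij; rewrite mxE nth_default //.
  by rewrite sizeP.
rewrite big1 ?unitr1 => [|i _]; last first.
  have := lead_coef_prod_XsubC (index_iota 1 i.+1) predT (fun l => a l%:Z).
  by rewrite lead_coefE sizeP mxE.
rewrite unitmxE det_Vandermonde unitfE; apply/prodf_neq0 => i _.
apply/prodf_neq0 => j ij; rewrite !mxE subr_eq0 (inj_eq inj_y).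
by rewrite -val_eqE /= gtn_eqF.
Qed.

(** * The matrix of the generating series of the Lambda_k *)

Fact fps_const_is_zmod_morphism (R : nzRingType) : zmod_morphism (@fps_const R).
Proof.
move=> u v; apply: fpsP => j; rewrite fps_coefD fps_coefN.
by case: j => //= _; rewrite subrr.
Qed.
Fact fps_const_is_monoid_morphism (R : nzRingType) :
  monoid_morphism (@fps_const R).
Proof.
split=> // u v; apply: fpsP => j; rewrite fps_coefCM.
by case: j => //= _; rewrite mulr0.
Qed.
HB.instance Definition _ (R : nzRingType) :=
  GRing.isZmodMorphism.Build R (fps R) (@fps_const R)
    (@fps_const_is_zmod_morphism R).
HB.instance Definition _ (R : nzRingType) :=
  GRing.isMonoidMorphism.Build R (fps R) (@fps_const R)
    (@fps_const_is_monoid_morphism R).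

(** For an equidistant sequence, shifting a amounts to translating y. *)
Lemma ffact_shift (K : fieldType) (A : lalgType K) (a : int -> K) (c : K)
    (equid : forall m k : int, a (m + k) - a k = c *~ m) s (y : A) m :
  ffact (shift s a) y m = ffact a (y - (c *~ s)%:A) m.
Proof.
apply: eq_bigr => k _; rewrite -addrA -opprD -scalerDl; congr (_ - _ *: _).
by rewrite /shift addrC -(equid s k) addrC subrK.
Qed.

(** In terms of z_l = x_l - c (l + 1 - n), l counted from 0, the exchange is the transposition of
    z_i and z_i1, and the column of index l depends on z_l only. *)
Lemma Lambda_mx_exchange (K : fieldType) (A : lalgType K) n (a : int -> K)
    (c : K) (equid : forall m k : int, a (m + k) - a k = c *~ m)
    (x : 'I_n -> A) (i i1 : 'I_n) (i1E : i1 = i.+1 :> nat) :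
  Lambda_mx a (exchange c i i1 x) =
  col_perm (lift_perm ord_max ord_max (tperm i i1)) (Lambda_mx a x).
Proof.
apply/matrixP => m j; rewrite !mxE.
case: (unliftP ord_max j) => [l ->|->]; last by rewrite lift_perm_id unlift_none.
rewrite lift_perm_lift liftK; congr fps_const.
rewrite !(ffact_shift equid); congr ffact.
have succ_shift (s : nat) : c *~ (s.+2%:Z - n%:Z) = c + c *~ (s.+1%:Z - n%:Z).
  by rewrite intS -addrA [LHS]mulrzDr mulr1z.
rewrite /exchange; case: (tpermP i i1 l) => [->|->|/eqP/negPf li /eqP/negPf li1].
- by rewrite eqxx i1E -addrA -opprD -scalerDl succ_shift.
- have /negPf-> : i1 != i by rewrite -val_eqE /= i1E gtn_eqF.
  by rewrite eqxx i1E succ_shift scalerDl opprD addrA addrK.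
- by rewrite li li1.
Qed.

Lemma Lambda_defined_exchange (K : fieldType) (A : lalgType K) n (a : int -> K)
    (c : K) (equid : forall m k : int, a (m + k) - a k = c *~ m)
    (x : 'I_n -> A) (i i1 : 'I_n) (i1E : i1 = i.+1 :> nat) :
  Lambda_defined a x -> Lambda_defined a (exchange c i i1 x).
Proof.
rewrite /Lambda_defined (Lambda_mx_exchange equid x i1E).
exact: quasidet_defined_col_perm.
Qed.

(** The universal property of the free skew field, for assignments into the
    field K itself. *)
Lemma free_specialization (K : fieldType) n (D : unitAlgType K) (x : 'I_n -> D)
    (freeD : free_skew_field x) (y : 'I_n -> K) :
  exists (L : {pred D}) (phi : D -> K),
    [/\ local_specialization L phi, forall i, x i \in L &
        forall i, phi (x i) = y i].
Proof.
have skewK : skew_field (K^o : unitAlgType K) by move=> d; rewrite unitfE.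
have [L [phi [[Lalg Lx] [phi1 philin] phiM phix invL]]] :=
  free_skew_field_univ freeD (y : 'I_n -> K^o) skewK.
have phi0 : phi 0 = 0.
  have [L1 _ _] := Lalg.
  by rewrite -(addNr 1) -scaleN1r philin // phi1 [_ *: _]mulr1 addNr.
exists L, phi; split=> //; split=> // d Ld phid.
apply: (free_skew_field_skew freeD).
by apply: contraNneq phid => ->; rewrite phi0.
Qed.

(** Over a skew field, factorial powers of merely distinct elements may be
    dependent (conjugate elements can be roots of one polynomial of low
    degree); the freeness of x is used to specialize to distinct elements of
    the commutative field K. *)
Lemma Lambda_defined_free (K : fieldType) (charK : [pchar K] =i pred0)
    n (D : unitAlgType K) (x : 'I_n -> D) (freeD : free_skew_field x)
    (a : int -> K) (c : K) (equid : forall m k : int, a (m + k) - a k = c *~ m) :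
  Lambda_defined a x.
Proof.
pose s (l : 'I_n) : int := l.+1%:Z - n%:Z.
(* The values are chosen so that x l - c (s l) specializes to l. *)
have [L [phi [specL Lx phix]]] :=
  free_specialization freeD (fun l => l%:R + c *~ s l).
pose V : 'M[D]_n := \matrix_(m, l) ffact (shift (s l) a) (x l) m.
have VE (m l : 'I_n) : V m l \in L /\ phi (V m l) = ffact a (l%:R : K^o) m.
  have Lz k : x l - (c *~ s l)%:A - (a k)%:A \in L.
    by rewrite !(spec_inB specL) ?(spec_inA specL).
  rewrite mxE (ffact_shift equid).
  have [-> ->] := spec_prod specL (index_iota 1 m.+1) (fun k => Lz k%:Z).
  split=> //; apply: eq_bigr => k _.
  rewrite !(specB specL) ?(spec_inB specL) ?(spec_inA specL) //.
  by rewrite !(specA specL) phix addrK [(a k)%:A]mulr1.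
have [i j||B VB] := @spec_invertible _ _ _ _ specL _ V.
- by case: (VE i j).
- have -> : map_mx phi V = \matrix_(m < n, l < n) ffact a (l%:R : K^o) m.
    by apply/matrixP => m l; rewrite mxE [RHS]mxE; case: (VE m l).
  apply: (@ffact_Vandermonde_unit _ _ _ (fun l : 'I_n => l%:R)) => l l'.
  by move/(pchar0_natr_inj charK)/val_inj.
rewrite /Lambda_defined /quasidet_defined.
have -> : row' ord_max (col' ord_max (Lambda_mx a x)) = map_mx (@fps_const D) V.
  by apply/matrixP => m l; rewrite !mxE liftK lift_max.
by exists (map_mx (@fps_const D) B); exact: mx_inverse_map.
Qed.

Theorem proposition57 (K : fieldType) (charK : [pchar K] =i pred0)
    (n : nat) (D : unitAlgType K) (x : 'I_n -> D)
    (freeD : free_skew_field x)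
    (a : int -> K) (c : K) (equid : forall m k : int, a (m + k) - a k = c *~ m)
    (i i1 : 'I_n) (i1E : i1 = i.+1 :> nat) :
  let x' := exchange c i i1 x in
  [/\ Lambda_defined a x /\ Lambda_defined a x',
      forall k : nat, Lambda a x k = Lambda a x' k,
      forall k : nat, Sfun a x k = Sfun a x' k &
      forall (r : nat) (I : r.+1.-tuple nat), (forall p, (0 < tnth I p)%N) ->
        ribbon_at a x I = ribbon_at a x' I].
Proof.
move=> x'.
have LambdaE : Lambda a x = Lambda a x'.
  by rewrite /Lambda (Lambda_mx_exchange equid x i1E) quasidet_col_perm.
have SfunE : Sfun a x = Sfun a x' by rewrite /Sfun LambdaE.
have def_x := Lambda_defined_free charK freeD equid.
split.
- by split; last exact: (Lambda_defined_exchange equid i1E def_x).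
- by move=> k; rewrite LambdaE.
- by move=> k; rewrite SfunE.
- by move=> r I _; rewrite /ribbon_at SfunE.
Qed.
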